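(* Let $R$ be a valuation ring with maximal ideal $P$, and let $Z$ be the set of zero-divisors of $R$. Then the following conditions are equivalent: (1) $R$ is self injective (i.e. injective as an $R$-module); (2) each singly projective $R$-module is locally projective; (3) $Z=P$ and each singly projective $R$-module is finitely projective.
   Context: A valuation ring is a commutative ring $R$ (possibly with zero-divisors) whose set of ideals is totally ordered by inclusion. $Z=\{s\in R\mid \exists\, 0\ne x\in R,\ sx=0\}$ (it is a prime ideal). An $R$-module $M$ is finitely projective (respectively singly projective) if, for any finitely generated (respectively cyclic) submodule $N$ of $M$, the inclusion map $N\to M$ factors through a free module. $M$ is locally projective if, for any finitely generated submodule $N$ of $M$, there exist a free module $F$ and homomorphisms $\phi:M\to F$ and $\pi:F\to M$ such that $\pi(\phi(x))=x$ for all $x\in N$. *)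

(* Defs.v *)
From HB Require Import structures.
From mathcomp Require Import all_boot all_order all_algebra.
From mathcomp Require Import boolp classical_sets.

Set Implicit Arguments.
Unset Strict Implicit.
Unset Printing Implicit Defensive.

Import GRing.Theory.
Local Open Scope classical_set_scope.
Local Open Scope ring_scope.

Section Rings.
Variable R : comNzRingType.

(* Unlike [idealr_closed], this allows the unit ideal. *)
Definition is_ideal (I : set R) : Prop :=
  [/\ I 0,
      forall x y, I x -> I y -> I (x + y)
    & forall a x, I x -> I (a * x)].

Definition maximal_ideal (P : set R) : Prop :=
  [/\ is_ideal P, P <> [set: R]
    & forall J : set R, is_ideal J -> P `<=` J -> J = P \/ J = [set: R]].

(* Zero-divisors are allowed: R is not assumed to be a domain. *)
Definition valuation_ring : Prop :=
  forall I J : set R, is_ideal I -> is_ideal J -> I `<=` J \/ J `<=` I.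

(* 0 is a zero-divisor. *)
Definition zero_divisors : set R :=
  [set s | exists x : R, x != 0 /\ s * x = 0].

End Rings.
Arguments valuation_ring : clear implicits.
Arguments zero_divisors : clear implicits.

Section Modules.
Variable R : comNzRingType.
Implicit Types M N F E : lmodType R.

Definition finitely_generated N : Prop :=
  exists (n : nat) (g : 'I_n -> N),
    forall x : N, exists c : 'I_n -> R, x = \sum_(i < n) c i *: g i.

Definition cyclic_module N : Prop :=
  exists g : N, forall x : N, exists a : R, x = a *: g.

Definition is_basis F (B : set F) : Prop :=
  (forall (s : seq F) (c : F -> R),
     uniq s -> (forall b, b \in s -> B b) ->
     \sum_(b <- s) c b *: b = 0 -> forall b, b \in s -> c b = 0) /\
  (forall x : F, exists (s : seq F) (c : F -> R),
     (forall b, b \in s -> B b) /\ x = \sum_(b <- s) c b *: b).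

Definition free_module F : Prop := exists B : set F, is_basis B.

Definition injective_module E : Prop :=
  forall (A B : lmodType R) (i : {linear A -> B}) (f : {linear A -> E}),
    injective i -> exists g : {linear B -> E}, forall x : A, g (i x) = f x.

(* A submodule of M is a [subLmodType S] with S : pred M, with inclusion map
   [val]. *)
Definition inclusion_factors_through_free M (S : pred M)
    (N : subLmodType S) : Prop :=
  exists (F : lmodType R) (u : {linear N -> F}) (v : {linear F -> M}),
    free_module F /\ forall x : N, v (u x) = val x.

Definition finitely_projective M : Prop :=
  forall (S : pred M) (N : subLmodType S),
    finitely_generated N -> inclusion_factors_through_free N.

Definition singly_projective M : Prop :=
  forall (S : pred M) (N : subLmodType S),
    cyclic_module N -> inclusion_factors_through_free N.

Definition locally_projective M : Prop :=
  forall (S : pred M) (N : subLmodType S),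
    finitely_generated N ->
    exists (F : lmodType R) (phi : {linear M -> F}) (pi : {linear F -> M}),
      free_module F /\ forall x : N, pi (phi (val x)) = val x.

End Modules.

Definition self_injective (R : comNzRingType) : Prop :=
  injective_module (R^o : lmodType R).

(* Main.v *)
Require Import Defs.
From HB Require Import structures.
From mathcomp Require Import all_boot all_order all_algebra.
From mathcomp Require Import boolp classical_sets functions.
From mathcomp Require Import freeg.

(* Over a chain ring, [M] is singly projective iff every [x] in [M] is [a *: y]
   with [ann x = ann a]: take for [a] a gcd of the coordinates of the image of
   [x] in a free module.
   (1) => (2): self-injectivity extends [x |-> a] to [M], so each single element
   is fixed by an endomorphism factoring through a free module, and such
   endomorphisms can be combined to fix finitely many elements.
   (2) => (3): if [s] in [P] is regular, an injective module containing [R]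
   contains a copy of the localization [R[1/s]]; it is singly projective, and
   local projectivity would make [s] a unit.
   (3) => (1): when [Z = P], the injective hull [E] of [R] is singly, hence
   finitely, projective.  For [e] in [E], a factorization of [<1, e>] through a
   free module has a coordinate which is a unit at [1], and essentiality then
   forces [e] into [R]; thus [R = E].
   Injective modules containing [R] are obtained as additive maps from [R] to a
   divisible group containing [R]. *)

Set Implicit Arguments.
Unset Strict Implicit.
Unset Printing Implicit Defensive.

Import Order.TTheory GRing.Theory Num.Theory.
Local Open Scope classical_set_scope.
Local Open Scope ring_scope.
Local Open Scope quotient_scope.

(** * Submodules and Baer's criterion *)

Section Submodules.
Variable R : comNzRingType.
Implicit Types X E : lmodType R.

Definition is_submod X (A : set X) : Prop :=
  A 0 /\ forall a x y, A x -> A y -> A (a *: x + y).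

Definition linear_on X E (A : set X) (f : X -> E) : Prop :=
  forall a x y, A x -> A y -> f (a *: x + y) = a *: f x + f y.

(** Baer's condition: extending a map from an ideal to [R] amounts to choosing the image [e] of
    1. *)
Definition baer E : Prop :=
  forall (L : set R^o) (g : R^o -> E), is_submod L -> linear_on L g ->
    exists e, forall a : R, L a -> g a = a *: e.

Lemma submodD X (A : set X) x y : is_submod A -> A x -> A y -> A (x + y).
Proof. by move=> [_ AD] Ax Ay; rewrite -[x]scale1r; exact: AD. Qed.

Lemma submodZ X (A : set X) a x : is_submod A -> A x -> A (a *: x).
Proof. by move=> [A0 AD] Ax; rewrite -[_ *: _]addr0; exact: AD. Qed.

Lemma submodN X (A : set X) x : is_submod A -> A x -> A (- x).
Proof. by move=> sA Ax; rewrite -scaleN1r; exact: submodZ. Qed.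

Lemma linear_on0 X E (A : set X) (f : X -> E) :
  is_submod A -> linear_on A f -> f 0 = 0.
Proof.
move=> [A0 _] /(_ 1 _ _ A0 A0); rewrite !scale1r addr0 => /eqP.
by rewrite -subr_eq subrr => /eqP.
Qed.

(** Zorn's lemma for submodules. The bound [U] is any set, so that it can express single-valuedness
    of a relation or essentiality of an extension. *)
Lemma max_submod X (A U : set X) : is_submod A -> A `<=` U ->
  exists H, [/\ is_submod H, A `<=` H, H `<=` U &
    forall H', is_submod H' -> H `<=` H' -> H' `<=` U -> H' `<=` H].
Proof.
move=> sA AU.
(* [A] is added to the members so that the empty chain has a bound above [A]. *)
pose P := [set B : set X | is_submod (A `|` B) /\ B `<=` U].
have [F FP totF|B [[sB BU] maxB]] := @Zorn_bigcup X P.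
  split=> [|x [B /FP[_ BU] /BU //]].
  split=> [|a x y]; first by left; case: sA.
  move=> [Ax|[B FB Bx]] [Ay|[C FC Cy]].
  - by left; apply: (proj2 sA).
  - have [sC _] := FP _ FC.
    have [|] := proj2 sC a x y (or_introl Ax) (or_intror Cy); first by left.
    by right; exists C.
  - have [sC _] := FP _ FB.
    have [|] := proj2 sC a x y (or_intror Bx) (or_introl Ay); first by left.
    by right; exists B.
  - have [BC|CB] := totF _ _ FB FC.
    + have [sC _] := FP _ FC.
      have [|] := proj2 sC a x y (or_intror (BC _ Bx)) (or_intror Cy).
        by left.
      by right; exists C.
    + have [sC _] := FP _ FB.
      have [|] := proj2 sC a x y (or_intror Bx) (or_intror (CB _ Cy)).
        by left.
      by right; exists B.
exists (A `|` B); split=> //; first by move=> x [/AU|/BU].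
move=> H' sH' sub H'U; apply: contrapT => nsub.
apply: (maxB H').
  split=> [x Bx|Bs]; first by apply: sub; right.
  by apply: nsub => x /Bs; right.
split=> //; suff -> : A `|` H' = H' by [].
by apply/seteqP; split=> x; [move=> [Ax|//]; apply: sub; left|right].
Qed.

Definition adjoin X (H : set X) (v : X) : set X :=
  [set w | exists a p, H p /\ w = a *: v + p].

Lemma adjoin_submod X (H : set X) v : is_submod H -> is_submod (adjoin H v).
Proof.
move=> [H0 HD]; split; first by exists 0, 0; rewrite scale0r addr0.
move=> a _ _ [b [p [Hp ->]]] [c [q [Hq ->]]].
exists (a * b + c), (a *: p + q); split; first exact: HD.
by rewrite scalerDr scalerA addrACA scalerDl.
Qed.

Lemma sub_adjoin X (H : set X) v : H `<=` adjoin H v.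
Proof. by move=> p Hp; exists 0, p; rewrite scale0r add0r. Qed.

Lemma mem_adjoin X (H : set X) v : is_submod H -> adjoin H v v.
Proof. by case=> H0 _; exists 1, 0; rewrite scale1r addr0. Qed.

Lemma mk_linear X E (f : X -> E) :
  (forall a x y, f (a *: x + y) = a *: f x + f y) ->
  exists h : {linear X -> E}, h =1 f.
Proof.
move=> lf.
pose fL := GRing.isLinear.Build R X E *:%R f lf.
pose h : {linear X -> E} := HB.pack f fL.
by exists h.
Qed.

Definition graph_on X E (A : set X) (f : X -> E) : set (X * E)%type :=
  [set p | A p.1 /\ p.2 = f p.1].

Lemma graph_on_submod X E (A : set X) (f : X -> E) :
  is_submod A -> linear_on A f -> is_submod (graph_on A f).
Proof.
move=> sA lf; split=> [|a [x1 x2] [y1 y2] /= [Ax /= ->] [Ay /= ->]].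
  by split=> /=; [case: sA|rewrite (linear_on0 sA lf)].
by split=> /=; [apply: (proj2 sA)|rewrite lf].
Qed.

(** Encoding partial maps as graphs in [X * E] lets Zorn's lemma give a maximal extension; Baer's
    condition makes it total. *)
Lemma baer_extend E : baer E -> forall X (A : set X) (f : X -> E),
  is_submod A -> linear_on A f ->
  exists h : {linear X -> E}, forall x, A x -> h x = f x.
Proof.
move=> bE X A f sA lf.
(* A submodule of [X * E] is the graph of a partial map when only 0 lies over 0. *)
pose U : set (X * E)%type := [set p | p.1 = 0 -> p.2 = 0].
have sG := graph_on_submod sA lf.
have [|H [sH GH HU maxH]] := max_submod sG (U := U).
  by move=> p [_ pE] p0; rewrite pE p0; exact: linear_on0 lf.
have funH b y y' : H (b, y) -> H (b, y') -> y = y'.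
  move=> Hy Hy'; apply/eqP; rewrite -subr_eq0; apply/eqP.
  have /HU : H ((b, y) - (b, y')) by apply: submodD => //; exact: submodN.
  by apply => /=; exact: subrr.
have totH b : exists y, H (b, y).
  (* [L] is the ideal of multipliers bringing [b] into the domain; the [e] representing the map
     there is a consistent value at [b]. *)
  pose L : set R^o := [set a | exists y, H (a *: b, y)].
  have [g gP] : exists g : R^o -> E, forall a, L a -> H (a *: b, g a).
    have /choice[g gP] : forall a, exists y, L a -> H (a *: b, y).
      move=> a; have [[y Hy]|nL] := pselect (L a); first by exists y.
      by exists 0.
    by exists g.
  have HD a c d y z : H (c *: b, y) -> H (d *: b, z) ->
      H ((a * c + d) *: b, a *: y + z).
    by move=> Hy Hz; rewrite scalerDl -scalerA; exact: (proj2 sH _ _ _ Hy Hz).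
  have sL : is_submod L.
    split; first by exists 0; rewrite scale0r; case: sH.
    by move=> a c d [y Hy] [z Hz]; exists (a *: y + z); exact: HD.
  have lg : linear_on L g.
    move=> a c d Lc Ld; have /gP Lacd := proj2 sL a c d Lc Ld.
    by apply: funH Lacd _; apply: HD; exact: gP.
  have [e eP] := bE L g sL lg.
  exists e; apply: (maxH (adjoin H (b, e))).
  - exact: adjoin_submod.
  - exact: sub_adjoin.
  - move=> _ [a [[p q] [Hp ->]]] ab0.
    have abE : a *: b = - p by apply/eqP; rewrite -addr_eq0; exact/eqP.
    have La : H (a *: b, - q).
      by rewrite abE; exact: (submodN sH Hp).
    have ga : H (a *: b, g a) by apply: gP; exists (- q).
    change (a *: e + q = 0); rewrite -eP; last by exists (- q).
    by rewrite (funH _ _ _ ga La) addNr.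
  - exact: mem_adjoin.
have [h0 h0P] := choice totH.
have [a x y|h hE] := mk_linear (f := h0).
  by apply: funH (h0P _) _; exact: (proj2 sH a _ _ (h0P x) (h0P y)).
exists h => x Ax; rewrite hE.
by apply: funH (h0P x) _; apply: GH.
Qed.

Lemma baer_injective E : baer E -> injective_module E.
Proof.
move=> bE A B i f inji.
have [g0 g0P] : exists g : B -> E, forall x, g (i x) = f x.
  have /choice[g gP] : forall b, exists e, forall x, i x = b -> e = f x.
    move=> b; have [[x <-]|nb] := pselect (exists x, i x = b).
      by exists (f x) => y /inji ->.
    by exists 0 => x ib; case: nb; exists x.
  by exists g => x; exact: gP.
have [||g gP] := @baer_extend E bE B (range i) g0.
- split; first by exists 0; rewrite ?linear0.
  by move=> a _ _ [x _ <-] [y _ <-]; exists (a *: x + y); rewrite // linearP.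
- move=> a _ _ [x _ <-] [y _ <-].
  by rewrite -linearP !g0P linearP.
by exists g => x; rewrite gP ?g0P //; exists x.
Qed.

End Submodules.

(** * Embedding a ring in an injective module *)

(** A nonzero ideal of the integers is generated by its least positive element [n]; dividing the
    image of [n] by [n] gives the representing element. *)
Lemma divisible_baer (E : lmodType int) :
  (forall (n : int) (e : E), n != 0 -> exists e', e = n *: e') -> baer E.
Proof.
move=> divE L g sL lg.
have [[n0 [n0_gt0 Ln0]]|noL] :=
    pselect (exists n : nat, (0 < n)%N /\ L (n%:Z : int^o)); last first.
  exists 0 => a La; rewrite scaler0.
  have [->|a0] := eqVneq a 0; first exact: linear_on0 lg.
  case: noL; exists `|a|%N; split; first by rewrite absz_gt0.
  rewrite abszE; have [_|_] := ger0P a; first exact: La.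
  exact: (submodN sL La).
have exn : exists n : nat, `[< (0 < n)%N /\ L (n%:Z : int^o) >].
  by exists n0; apply/asboolP.
have [n /asboolP[n_gt0 Ln] minn] := ex_minnP exn.
have n0' : n%:Z != 0 by rewrite -lt0n.
have [e' gnE] := divE _ (g n%:Z) n0'.
exists e' => a La.
have Lmod : L ((a %% n)%Z : int^o).
  have -> : (a %% n)%Z = a - (a %/ n)%Z * n%:Z.
    by rewrite {2}(divz_eq a n) addrC addKr.
  exact: (submodD sL La (submodN sL (submodZ (a %/ n)%Z sL Ln))).
have mod0 : (a %% n)%Z = 0.
  apply/eqP; apply: contrapT => /negP r0.
  have rpos : 0 <= (a %% n)%Z by rewrite modz_ge0.
  have : (n <= `|(a %% n)%Z|)%N.
    apply: minn; apply/asboolP; split; first by rewrite absz_gt0.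
    by rewrite gez0_abs.
  rewrite leqNgt => /negP; apply.
  by rewrite -ltz_nat gez0_abs // ltz_pmod.
have aE : a = (a %/ n)%Z * n%:Z by rewrite {1}(divz_eq a n) mod0 addr0.
have L0 : L 0 by case: sL.
have := lg (a %/ n)%Z (n%:Z : int^o) 0 Ln L0.
rewrite addr0 (linear_on0 sL lg) addr0 => gE.
transitivity (g ((a %/ n)%Z *: (n%:Z : int^o))); first exact: (congr1 g aE).
by rewrite gE gnE scalerA -aE.
Qed.

(** * The divisible hull of an abelian group *)

Section DivisibleHull.
Variable A : zmodType.

Definition int_eval : {freeg A / int} -> zmodule A :=
  fglift (fun x : A => x : zmodule A).

Lemma int_evalB : zmod_morphism int_eval.
Proof. exact: lift_is_additive. Qed.

(* Integral combinations of generators that evaluate to [0] in [A]; the quotient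
   of the rational combinations by them is divisible and contains [A]. *)
Definition int_relation : {pred {freeg A / rat}} := fun D =>
  `[< exists E : {freeg A / int},
        (forall x, coeff x D = (coeff x E)%:~R) /\
        int_eval E = 0 >].

Lemma int_relation_closed : zmod_closed int_relation.
Proof.
split=> [|D1 D2 /asboolP[E1 [c1 l1]] /asboolP[E2 [c2 l2]]]; apply/asboolP.
  exists 0; split=> [x|]; first by rewrite !coeff0.
  by rewrite -[0](subrr 0) int_evalB subrr.
exists (E1 - E2); split=> [x|]; last by rewrite int_evalB l1 l2 subr0.
by rewrite !coeffB c1 c2 rmorphB.
Qed.

HB.instance Definition _ :=
  GRing.isZmodClosed.Build {freeg A / rat} int_relation int_relation_closed.

Definition divisible_hull : zmodType := Quotient.quot int_relation.

Definition to_hull (x : A) : divisible_hull :=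
  \pi_(Quotient.quot int_relation) << 1 *g x >>.

Lemma to_hull_additive : zmod_morphism to_hull.
Proof.
move=> x y; rewrite /to_hull -raddfB /=.
apply/eqP; rewrite -Quotient.idealrBE; apply/asboolP.
exists (<< 1 *g x - y >> - (<< 1 *g x >> - << 1 *g y >>)); split=> [z|].
  by rewrite !coeffB !coeffU !mul1r !rmorphB /= !mulrz_nat.
by rewrite !int_evalB /int_eval !liftU !scale1r subrr.
Qed.

(** The integral combination witnessing the relation is determined by its coefficients, hence is the
    generator at [x], which evaluates to [x]. *)
Lemma to_hull_eq0 x : to_hull x = 0 -> x = 0.
Proof.
rewrite /to_hull -[0](raddf0 \pi_(Quotient.quot int_relation)) => /eqP.
rewrite -Quotient.idealrBE subr0 => /asboolP[E [cE lE]].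
suff EE : E = << 1 *g x >> by move: lE; rewrite EE /int_eval liftU scale1r.
apply/eqP/freeg_eqP => z; apply: (@intr_inj rat).
by rewrite -cE !coeffU !mul1r mulrz_nat.
Qed.

Lemma divisible_hull_div (n : int) (v : divisible_hull) :
  n != 0 -> exists w : divisible_hull, v = w *~ n.
Proof.
move=> n0; pose D := repr v.
exists (\pi_(Quotient.quot int_relation) ((n%:~R^-1 : rat) *: D)).
rewrite -raddfMz /= -scaler_int scalerA mulfV ?intr_eq0 // scale1r.
by rewrite /D reprK.
Qed.

End DivisibleHull.

(** * The coinduced module of additive maps *)

Section Coinduced.
Variables (R : comNzRingType) (V : zmodType).

Definition additive_pred : {pred R -> V} := fun h => `[< zmod_morphism h >].

Lemma additive_pred_closed : zmod_closed additive_pred.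
Proof.
split=> [|h1 h2 /asboolP l1 /asboolP l2]; apply/asboolP => x y.
  by rewrite subr0.
change (h1 (x - y) - h2 (x - y) = (h1 x - h2 x) - (h1 y - h2 y)).
by rewrite l1 l2 !opprD !opprK !addrA; congr (_ + _); exact: addrAC.
Qed.

HB.instance Definition _ :=
  GRing.isZmodClosed.Build (R -> V) additive_pred additive_pred_closed.

Definition coinduced := {h : R -> V | h \in additive_pred}.

HB.instance Definition _ := SubChoice.on coinduced.
HB.instance Definition _ := [SubChoice_isSubZmodule of coinduced by <:].

Lemma coinducedB (h : coinduced) : zmod_morphism (val h).
Proof. exact/asboolP/(valP h). Qed.

Lemma coinduced_additive (h : coinduced) :
  exists f : {additive R -> V}, f =1 val h.
Proof.
pose fA := GRing.isZmodMorphism.Build R V (val h) (coinducedB h).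
pose f : {additive R -> V} := HB.pack (val h) fA.
by exists f.
Qed.

Lemma coinducedD (h : coinduced) x y : val h (x + y) = val h x + val h y.
Proof. by have [f fE] := coinduced_additive h; rewrite -!fE raddfD. Qed.

Lemma coinducedMz (h : coinduced) x n : val h (x *~ n) = val h x *~ n.
Proof. by have [f fE] := coinduced_additive h; rewrite -!fE raddfMz. Qed.

Lemma coinduced_scale_subproof (a : R) (h : coinduced) :
  (fun s => val h (s * a)) \in additive_pred.
Proof. by apply/asboolP => x y; rewrite mulrBl coinducedB. Qed.

Definition coinduced_scale a h : coinduced :=
  exist (fun f => f \in additive_pred) _ (coinduced_scale_subproof a h).

Lemma coinduced_scaleA a b h :
  coinduced_scale a (coinduced_scale b h) = coinduced_scale (a * b) h.
Proof. by apply/val_inj/funext => s /=; rewrite mulrA. Qed.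

Lemma coinduced_scale1 : left_id 1 coinduced_scale.
Proof. by move=> h; apply/val_inj/funext => s /=; rewrite mulr1. Qed.

Lemma coinduced_scaleDr : right_distributive coinduced_scale +%R.
Proof. by move=> a h1 h2; apply/val_inj/funext. Qed.

Lemma coinduced_scaleDl h : {morph coinduced_scale^~ h : a b / a + b}.
Proof.
move=> a b; apply/val_inj/funext => s.
by rewrite [LHS]/= mulrDr coinducedD.
Qed.

HB.instance Definition _ := GRing.Zmodule_isLmodule.Build R coinduced
  coinduced_scaleA coinduced_scale1 coinduced_scaleDr coinduced_scaleDl.

Lemma coinduced_scaleE a (h : coinduced) s : val (a *: h) s = val h (s * a).
Proof. by []. Qed.

Lemma coinducedDE (h1 h2 : coinduced) s :
  val (h1 + h2) s = val h1 s + val h2 s.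
Proof. by []. Qed.

(** Evaluation at 1 turns a linear map into [coinduced] into an additive map into [V], which extends
    to all of [R] because [V] is divisible; the extension is itself the representing element. *)
Lemma coinduced_baer : (forall (n : int) (v : V), n != 0 ->
  exists w, v = w *~ n) -> baer coinduced.
Proof.
move=> divV L g sL lg.
have bV : baer (zmodule V).
  by apply: divisible_baer => n v /(divV n v)[w ->]; exists w.
have gD a b : L a -> L b -> g (a + b) = g a + g b.
  by move=> La Lb; have := lg 1 a b La Lb; rewrite !scale1r.
pose f (x : zmodule R) : zmodule V := val (g x) 1.
have nE (n : int) (x : R) : n *: (x : zmodule R) = n%:~R * x.
  by rewrite scalezrE mulrzl.
have Ln n x : L x -> L (n *: (x : zmodule R)).
  by move=> Lx; rewrite nE; exact: (submodZ n%:~R sL Lx).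
have sLz : is_submod (L : set (zmodule R)).
  split; first by case: sL.
  by move=> n x y Lx Ly; apply: (submodD sL) => //; exact: Ln.
have lf : linear_on (L : set (zmodule R)) f.
  move=> n x y Lx Ly; rewrite /f gD //; last exact: Ln.
  have gn : g (n *: (x : zmodule R)) = n%:~R *: g x.
    have := lg n%:~R (x : R^o) 0 Lx (proj1 sL).
    by rewrite !addr0 (linear_on0 sL lg) addr0 nE.
  by rewrite coinducedDE gn coinduced_scaleE mul1r coinducedMz.
have [h hE] := baer_extend bV sLz lf.
have hP : (h : R -> V) \in additive_pred.
  by apply/asboolP => x y; exact: (raddfB h).
exists (exist (fun f => f \in additive_pred) _ hP : coinduced) => a La.
apply/val_inj/funext => s.
rewrite coinduced_scaleE /=.
have Lsa : L (s * a) by exact: (submodZ s sL La).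
have := lg s (a : R^o) 0 La (proj1 sL).
rewrite !addr0 (linear_on0 sL lg) addr0 => gsa.
by rewrite (hE _ Lsa) /f [s * a]/(s *: (a : R^o)) gsa coinduced_scaleE mul1r.
Qed.

End Coinduced.

Section InjectiveExtension.
Variable R : comNzRingType.

(** The embedding of [R] in its divisible hull is itself an element [d] of the coinduced module, and
    [a *: d] takes the value [to_hull a] at 1. *)
Lemma regular_in_baer : exists (D : lmodType R) (d : D),
  baer D /\ forall a : R, a *: d = 0 -> a = 0.
Proof.
pose V := divisible_hull R.
have dP : (@to_hull R : R -> V) \in @additive_pred R V.
  by apply/asboolP; exact: to_hull_additive.
exists (coinduced R V), (exist (fun f => f \in @additive_pred R V) _ dP); split.
  by apply: coinduced_baer => n v; exact: divisible_hull_div.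
move=> a /(congr1 (fun h => val h 1)); rewrite coinduced_scaleE /= mul1r.
exact: to_hull_eq0.
Qed.

End InjectiveExtension.

(** * Free and projective modules *)

Section SubmoduleType.
Variables (R : comNzRingType) (M : lmodType R).

Record submod := Submod { submod_set : set M; submodP : is_submod submod_set }.

Definition submod_pred (S : submod) : {pred M} :=
  fun x => `[< submod_set S x >].

Lemma submod_pred_closed S : submod_closed (submod_pred S).
Proof.
split=> [|a x y /asboolP Sx /asboolP Sy]; apply/asboolP.
  by case: (submodP S).
exact: (proj2 (submodP S)).
Qed.

HB.instance Definition _ S :=
  GRing.isSubmodClosed.Build R M (submod_pred S) (submod_pred_closed S).

Definition submod_type (S : submod) := {x : M | x \in submod_pred S}.

HB.instance Definition _ S := SubChoice.on (submod_type S).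
HB.instance Definition _ S := [SubChoice_isSubLmodule of submod_type S by <:].

Lemma submod_lmodule (A : set M) : is_submod A ->
  exists (S : pred M) (N : subLmodType S), forall x, x \in S <-> A x.
Proof.
move=> sA; exists (submod_pred (Submod sA)), (submod_type (Submod sA)) => x.
by split=> [/asboolP|Ax]; last exact/asboolP.
Qed.

Lemma span_submod n (x : 'I_n -> M) :
  is_submod [set y | exists c : 'I_n -> R, y = \sum_i c i *: x i].
Proof.
split=> [|a _ _ [c ->] [d ->]].
  by exists (fun=> 0); rewrite big1 // => i _; rewrite scale0r.
exists (fun i => a * c i + d i); rewrite scaler_sumr -big_split /=.
by apply: eq_bigr => i _; rewrite scalerDl scalerA.
Qed.

Lemma span_lmodule n (x : 'I_n -> M) :
  exists (S : pred M) (N : subLmodType S) (g : 'I_n -> N),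
    (forall i, val (g i) = x i) /\
    forall y : N, exists c : 'I_n -> R, y = \sum_i c i *: g i.
Proof.
have [S [N SP]] := submod_lmodule (span_submod x).
have xS i : x i \in S.
  apply/SP; exists (fun j => (j == i)%:R).
  rewrite (bigD1 i) //= eqxx scale1r big1 ?addr0 // => j /negPf ->.
  by rewrite scale0r.
exists S, N, (fun i => Sub (x i) (xS i)); split=> [i|y]; first exact: SubK.
have /SP[c yE] := valP y; exists c; apply: val_inj.
rewrite raddf_sum yE; apply: eq_bigr => i _.
by rewrite [RHS]GRing.valZ SubK.
Qed.

End SubmoduleType.

(** * Coordinates in free modules *)

Section Free.
Variable R : comNzRingType.
Implicit Types F M : lmodType R.

Definition coordinates F (k : F -> F -> R) : Prop :=
  (forall b a x y, k (a *: x + y) b = a * k x b + k y b) /\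
  (forall x, exists s : seq F, x = \sum_(b <- s) k x b *: b).

(** A spanning expression in [is_basis] may repeat a vector; merging repetitions makes independence,
    stated for duplicate-free lists, applicable. *)
Lemma sum_undup F (s : seq F) (c : F -> R) :
  \sum_(b <- s) c b *: b = \sum_(b <- undup s) (c b *+ count_mem b s) *: b.
Proof.
elim: s => [|x s IHs]; first by rewrite !big_nil.
rewrite big_cons IHs /=; case: ifP => xs.
  rewrite [RHS](bigD1_seq x) ?undup_uniq ?mem_undup //=.
  rewrite [in LHS](bigD1_seq x) ?undup_uniq ?mem_undup //=.
  rewrite eqxx addrA mulrS scalerDl; congr (_ + _).
  by apply: eq_bigr => b bx; rewrite eq_sym (negPf bx) add0n.
rewrite big_cons eqxx (count_memPn _) ?xs // addn0 mulr1n; congr (_ + _).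
rewrite [LHS]big_seq [RHS]big_seq; apply: eq_bigr => b; rewrite mem_undup => bs.
by case: eqP => [xb|_]; rewrite ?add0n // xb bs in xs.
Qed.

Lemma sum_support F (s t : seq F) (c : F -> R) : uniq s -> uniq t ->
  {subset s <= t} ->
  \sum_(b <- s) c b *: b = \sum_(b <- t) (if b \in s then c b else 0) *: b.
Proof.
move=> us ut st.
rewrite [RHS](bigID (mem s)) /= [X in _ + X]big1 ?addr0; last first.
  by move=> b /negPf ->; rewrite scale0r.
have st_perm : perm_eq s [seq b <- t | b \in s].
  apply: uniq_perm => //; first exact: filter_uniq.
  by move=> b; rewrite mem_filter andb_idr //; exact: st.
rewrite -[RHS]big_filter -(perm_big _ st_perm) /=.
by rewrite [LHS]big_seq [RHS]big_seq; apply: eq_bigr => b ->.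
Qed.

Lemma free_coordinates F : free_module F -> exists k, @coordinates F k.
Proof.
move=> [B [indB genB]].
have /choice[p pP] : forall x, exists p : seq F * (F -> R),
    [/\ uniq p.1, forall b, b \in p.1 -> B b & x = \sum_(b <- p.1) p.2 b *: b].
  move=> x; have [s [c [sB ->]]] := genB x.
  exists (undup s, fun b => c b *+ count_mem b s); split=> /=.
  - exact: undup_uniq.
  - by move=> b; rewrite mem_undup => /sB.
  - exact: sum_undup.
pose k x b := if b \in (p x).1 then (p x).2 b else 0.
have kE x t : uniq t -> {subset (p x).1 <= t} -> x = \sum_(b <- t) k x b *: b.
  by move=> ut st; have [us _ {1}->] := pP x; exact: sum_support.
exists k; split=> [b a x y|x]; last first.
  by exists (p x).1; apply: kE => //; have [] := pP x.
pose z := a *: x + y.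
(* Independence over the union of the three supports forces the coordinates of [z] to be the
   expected ones. *)
pose t := undup ((p x).1 ++ (p y).1 ++ (p z).1).
have ut : uniq t by exact: undup_uniq.
have xt : {subset (p x).1 <= t}.
  by move=> d ds; rewrite mem_undup !mem_cat ds.
have yt : {subset (p y).1 <= t}.
  by move=> d ds; rewrite mem_undup !mem_cat ds orbT.
have zt : {subset (p z).1 <= t}.
  by move=> d ds; rewrite mem_undup !mem_cat ds !orbT.
have [bt|bt] := boolP (b \in t); last first.
  have k0 w : {subset (p w).1 <= t} -> k w b = 0.
    by move=> wt; rewrite /k; case: ifP => // /wt; rewrite (negPf bt).
  by rewrite !k0 // mulr0 addr0.
apply/eqP; rewrite -subr_eq0; apply/eqP.
apply: (indB t (fun b => k z b - (a * k x b + k y b))) => //.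
  move=> d; rewrite mem_undup !mem_cat => /or3P[] ds.
  - by have [_ + _] := pP x; exact.
  - by have [_ + _] := pP y; exact.
  - by have [_ + _] := pP z; exact.
under eq_bigr do rewrite scalerBl scalerDl -scalerA.
rewrite sumrB big_split /= -scaler_sumr -!kE //.
by rewrite subrr.
Qed.

Lemma regular_free : free_module (R^o : lmodType R).
Proof.
exists [set 1]; split=> [s c us s1 + b bs|x].
  have /s1 /= bE := bs; rewrite bE (bigD1_seq b) //= big1_seq.
    by rewrite addr0 bE => /eqP; rewrite [_ *: _]mulr1 => /eqP.
  by move=> d /andP[+ /s1 dE]; rewrite bE dE eqxx.
exists [:: 1], (fun=> x); split=> [b|]; first by rewrite inE => /eqP.
by rewrite big_seq1 [_ *: _]mulr1.
Qed.

Lemma row_vector_free n : free_module ('rV[R]_n : lmodType R).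
Proof.
exists (range (fun i => delta_mx 0 i)); split=> [s c us sB s0 b bs|x].
  have [i _ ib] := sB b bs.
  have /matrixP/(_ 0 i) := s0; rewrite summxE mxE (bigD1_seq b) //=.
  rewrite big1_seq ?addr0.
    by rewrite -ib !mxE !eqxx mulr1.
  move=> d /andP[db ds]; have [j _ jd] := sB d ds.
  rewrite -jd !mxE eqxx /=; case: eqP => [ij|_]; last by rewrite mulr0.
  by move: db; rewrite -jd -ib ij eqxx.
pose d i : 'rV[R]_n := delta_mx 0 i.
have injd : injective d.
  move=> i j /matrixP/(_ 0 i); rewrite !mxE !eqxx /=.
  by case: (i =P j) => // _ /eqP; rewrite oner_eq0.
exists [seq d i | i <- enum 'I_n], (fun b => \sum_(i | d i == b) x 0 i).
split=> [b /mapP[i _ ->]|]; first by exists i.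
rewrite big_map big_enum /= {1}[x]row_sum_delta.
apply: eq_bigr => i _; congr (_ *: _).
by rewrite (bigD1 i) //= big1 ?addr0 // => j /andP[/eqP/injd -> ]; rewrite eqxx.
Qed.

End Free.

(** * Singly and locally projective modules over a chain ring *)

Section Projectivity.
Variable R : comNzRingType.
Implicit Types F M : lmodType R.

Section Coordinates.
Variables (F : lmodType R) (k : F -> F -> R).
Hypothesis kP : coordinates k.

Lemma coordinates0 b : k 0 b = 0.
Proof.
have := proj1 kP b 1 0 0; rewrite scale1r addr0 mul1r => /eqP.
by rewrite -subr_eq subrr => /eqP.
Qed.

Lemma coordinatesZ a x b : k (a *: x) b = a * k x b.
Proof. by rewrite -[a *: x]addr0 (proj1 kP) coordinates0 addr0. Qed.

Lemma coordinatesB x y b : k (x - y) b = k x b - k y b.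
Proof. by rewrite addrC -scaleN1r (proj1 kP) mulN1r addrC. Qed.

End Coordinates.

(** The coefficient [r] of a multiple of [g] is only a choice; the annihilator hypothesis makes
    [r * a] independent of it. *)
Lemma cyclic_functional M (g : M) (a : R) :
  (forall x, exists r, x = r *: g) -> (forall t, t *: g = 0 -> t * a = 0) ->
  exists u : {linear M -> R^o}, forall r, u (r *: g) = r * a.
Proof.
move=> /choice[r rP] aP.
have uP t b x y : t *: g = b *: x + y -> t * a = b * (r x * a) + r y * a.
  move=> tE; apply/eqP; rewrite -subr_eq0 mulrA -mulrDl -mulrBl; apply/eqP.
  by apply: aP; rewrite scalerBl scalerDl -scalerA -!rP tE subrr.
have [b x y|u uE] := @mk_linear R M (R^o : lmodType R) (fun x => r x * a).
  by apply: uP; rewrite -rP.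
exists u => t; rewrite uE; apply/esym; have := uP t 1 (t *: g) 0.
rewrite scale1r addr0 mul1r => /(_ erefl) ->.
by rewrite (aP (r 0)) ?addr0 // -rP.
Qed.

Definition chain_ring : Prop :=
  forall a b : R, (exists c, a = c * b) \/ (exists c, b = c * a).

Lemma valuation_chain : valuation_ring R -> chain_ring.
Proof.
move=> hR a b; pose I (x : R) := [set y | exists c, y = c * x].
have iI x : is_ideal (I x).
  split; first by exists 0; rewrite mul0r.
    by move=> _ _ [c ->] [d ->]; exists (c + d); rewrite mulrDl.
  by move=> c _ [d ->]; exists (c * d); rewrite mulrA.
have Ix x : I x x by exists 1; rewrite mul1r.
by have [/(_ a (Ix a))|/(_ b (Ix b))] := hR _ _ (iI a) (iI b); [left|right].
Qed.

(** Divisibility being total, a greatest common divisor is found among the elements; 0 serves the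
    empty list. *)
Lemma chain_gcd (I : eqType) (s : seq I) (c : I -> R) : chain_ring ->
  exists a (d : I -> R), (forall i, i \in s -> c i = d i * a) /\
    (a = 0 \/ exists2 i, i \in s & a = c i).
Proof.
move=> hR; elim: s => [|x s [a [d [dP aP]]]].
  by exists 0, (fun=> 0); split=> //; left.
have [[e xE]|[e aE]] := hR (c x) a.
  exists a, (fun i => if i == x then e else d i); split=> [i|].
    by rewrite inE; case: eqP => [-> //|_] /dP.
  by case: aP => [->|[i si ->]]; [left|right; exists i; rewrite ?inE ?si ?orbT].
exists (c x), (fun i => if i == x then 1 else d i * e); split=> [i|].
  rewrite inE; case: eqP => [-> _|_ /= /dP ->]; first by rewrite mul1r.
  by rewrite aE mulrA.
by right; exists x; rewrite ?mem_head.
Qed.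

(** Since [x = a *: y], the stated inclusion makes the annihilators of [x] and [a] equal. *)
Definition single_factor M : Prop := forall x : M,
  exists (a : R) (y : M), x = a *: y /\ forall t, t *: x = 0 -> t * a = 0.

Lemma singly_projective_factor M :
  chain_ring -> singly_projective M -> single_factor M.
Proof.
move=> hR pM x.
have [S [N [g [gE gP]]]] := @span_lmodule _ M 1 (fun=> x).
have [|F [u [v [/free_coordinates[k kP] uv]]]] := pM S N.
  exists (g ord0) => y; have [c ->] := gP y.
  by exists (c ord0); rewrite big_ord1.
pose w := u (g ord0).
have [s wE] := proj2 kP w.
have [a [d [dP aP]]] := chain_gcd s (k w) hR.
exists a, (v (\sum_(b <- s) d b *: b)); split.
  rewrite -linearZ scaler_sumr -(gE ord0) -uv -/w; congr (v _); rewrite wE.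
  rewrite [LHS]big_seq [RHS]big_seq; apply: eq_bigr => b bs.
  by rewrite dP // scalerA mulrC.
(* A scalar killing [x] kills all coordinates of [w], and [a] is 0 or one of them. *)
move=> t tx; case: aP => [->|[b bs ->]]; first by rewrite mulr0.
have tg : t *: g ord0 = 0.
  by apply: val_inj; rewrite GRing.valZ gE tx raddf0.
by rewrite -(coordinatesZ kP) /w -linearZ tg linear0 (coordinates0 kP).
Qed.

(** The inclusion factors through [R] itself: the generator goes to [a], and 1 goes to [y]. *)
Lemma factor_singly_projective M : single_factor M -> singly_projective M.
Proof.
move=> fM S N [g gP]; have [a [y [xE aP]]] := fM (val g).
have [t tg|u uE] := cyclic_functional (a := a) gP.
  by apply: aP; rewrite -GRing.valZ tg raddf0.
have [b n m|v vE] := @mk_linear R (R^o : lmodType R) M (fun t => t *: y).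
  by rewrite scalerDl [(_ *: _ : R^o)]/(b * n) scalerA.
exists (R^o : lmodType R), u, v; split=> [|n]; first exact: regular_free.
by have [r ->] := gP n; rewrite uE vE -scalerA -xE GRing.valZ.
Qed.

Lemma locally_finitely_projective M :
  locally_projective M -> finitely_projective M.
Proof.
move=> lM S N /lM[F [phi [pi [freeF piK]]]].
have [a x y|u uE] := @mk_linear R N F (fun x => phi (val x)).
  by rewrite !linearP.
by exists F, u, pi; split=> // x; rewrite uE.
Qed.

Lemma self_injective_locally_projective M :
  chain_ring -> self_injective R -> singly_projective M -> locally_projective M.
Proof.
move=> hR injR /(singly_projective_factor hR) fM.
(* Injectivity extends to [M] the functional that sends [x] to [a] on the span of [x]; then
   [phi x *: y = a *: y = x]. *)
have one x : exists (phi : {linear M -> R^o}) (y : M), phi x *: y = x.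
  have [a [y [xE aP]]] := fM x.
  have [S [N [g [gE gP]]]] := @span_lmodule _ M 1 (fun=> x).
  have {}gP n : exists r, n = r *: g ord0.
    by have [c ->] := gP n; exists (c ord0); rewrite big_ord1.
  have [t tg|u uE] := cyclic_functional (a := a) gP.
    by apply: aP; rewrite -(gE ord0) -GRing.valZ tg raddf0.
  have [phi phiE] := injR N M (val : {linear N -> M}) u val_inj.
  exists phi, y; rewrite -[in phi x](gE ord0) phiE -[g ord0]scale1r uE mul1r.
  exact/esym.
(* If [e] fixes some elements and [f] fixes [x - e x], then [e + f - f \o e]
   fixes the former and [x]. *)
have many (s : seq M) : exists p : seq ({linear M -> R^o} * M),
    forall x, x \in s -> \sum_(q <- p) q.1 x *: q.2 = x.
  elim: s => [|x s [p pP]]; first by exists [::].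
  pose e z := \sum_(q <- p) q.1 z *: q.2.
  have [a y z|eL eE] := @mk_linear R M M e.
    rewrite scaler_sumr -big_split; apply: eq_bigr => q _.
    by rewrite linearP scalerDl scalerA.
  have [f [y fy]] := one (x - eL x).
  have [a z w|phi phiE] :=
      @mk_linear R M (R^o : lmodType R) (fun z => f (z - eL z)).
    by rewrite -linearP; congr (f _); rewrite linearP opprD addrACA scalerBr.
  exists ((phi, y) :: p) => z; rewrite big_cons /= phiE.
  rewrite inE => /predU1P[->|/pP pz].
    by rewrite fy eE subrK.
  by rewrite eE /e pz subrr linear0 scale0r add0r.
move=> S N [n [g gP]].
(* The finitely many pairs in [p] define maps to and from a module of row vectors, one coordinate
   per pair. *)
have [p pP] := many [seq val (g i) | i <- enum 'I_n].
pose m := size p; pose q := tnth (in_tuple p).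
have [a x y|phi phiE] :=
    @mk_linear R M ('rV[R]_m : lmodType R) (fun x => \row_i (q i).1 x).
  by apply/rowP => i; rewrite !mxE linearP.
have [a x y|pi piE] :=
    @mk_linear R ('rV[R]_m : lmodType R) M (fun w => \sum_i w 0 i *: (q i).2).
  rewrite scaler_sumr -big_split; apply: eq_bigr => i _.
  by rewrite !mxE scalerDl scalerA.
exists ('rV[R]_m : lmodType R), phi, pi.
split=> [|x]; first exact: row_vector_free.
have fixg i : pi (phi (val (g i))) = val (g i).
  rewrite phiE piE -[RHS]pP; last by apply: map_f; rewrite mem_enum.
  rewrite (big_tnth _ _ p); apply: eq_bigr => j _; rewrite mxE.
  by rewrite /q /in_tuple.
have [c ->] := gP x.
have -> : val (\sum_i c i *: g i) = \sum_i c i *: val (g i).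
  by rewrite raddf_sum; apply: eq_bigr => i _; exact: GRing.valZ.
by rewrite !linear_sum; apply: eq_bigr => i _; rewrite !linearZ_LR fixg.
Qed.

End Projectivity.

(** * Essential hull and the equivalence *)

Section Hull.
Variable R : comNzRingType.

(** Baer's condition is applied to [c * b |-> c *: x] on the ideal generated by [b], a map well
    defined by the annihilator hypothesis. *)
Lemma baer_divide (E : lmodType R) (b : R) (x : E) :
  baer E -> (forall t, t * b = 0 -> t *: x = 0) -> exists e, x = b *: e.
Proof.
move=> bE bx; pose L : set R^o := [set a | exists c, a = c * b].
have /choice[q qP] : forall a : R, exists c, L a -> a = c * b.
  move=> a; have [[c ->]|nL] := pselect (L a); first by exists c.
  by exists 0.
have gE a c : a = c * b -> q a *: x = c *: x.
  move=> aE; have qb : a = q a * b by apply: qP; exists c.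
  apply/eqP; rewrite -subr_eq0 -scalerBl; apply/eqP/bx.
  by rewrite mulrBl -qb -aE subrr.
have Lc c : L (c * b) by exists c.
have [||e eP] := bE L (fun a => q a *: x).
- split; first by exists 0; rewrite mul0r.
  move=> a _ _ [c ->] [c' ->]; exists (a * c + c').
  by rewrite mulrDl -mulrA.
- move=> a _ _ [c ->] [c' ->].
  rewrite (gE _ (a * c + c')); last by rewrite mulrDl -mulrA.
  by rewrite scalerDl (gE (c * b) c erefl) (gE (c' * b) c' erefl) scalerA.
exists e; rewrite -eP; last by exists 1; rewrite mul1r.
by rewrite (gE b 1) ?mul1r ?scale1r.
Qed.

(** Together with [baer E], this makes [E] an injective hull of [R], embedded as the multiples of
    [d]. *)
Definition essential_over (E : lmodType R) (d : E) : Prop :=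
  (forall a : R, a *: d = 0 -> a = 0) /\
  forall x : E, x != 0 -> exists r a : R, a != 0 /\ r *: x = a *: d.

(** Take a maximal essential extension [H] of the multiples of [d] inside an injective [D]. To see
    that [H] satisfies Baer's condition, a map on an ideal is first extended as far as possible with
    values in [H]; the element [e] of [D] representing this extension keeps [H + R e] essential, so
    [e] lies in [H] by maximality. *)
Lemma essential_hull : exists (E : lmodType R) (d : E),
  baer E /\ essential_over d.
Proof.
have [D [d [bD dreg]]] := regular_in_baer R.
pose A : set D := [set x | exists a, x = a *: d].
pose U : set D :=
  [set x | x != 0 -> exists r a : R, a != 0 /\ r *: x = a *: d].
have [||H [sH AH HU maxH]] := @max_submod R D A U.
- split; first by exists 0; rewrite scale0r.
  by move=> a _ _ [b ->] [c ->]; exists (a * b + c); rewrite scalerDl scalerA.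
- move=> _ [a ->] ad; exists 1, a; rewrite scale1r; split=> //.
  by apply: contra_neq ad => ->; rewrite scale0r.
have Hd : H d by apply: AH; exists 1; rewrite scale1r.
have [S [E SP]] := submod_lmodule sH.
have dS : d \in S by exact/SP.
exists E, (Sub d dS); split; last first.
  split=> [a ad|x x0].
    by apply: dreg; rewrite -(SubK E dS) -GRing.valZ ad raddf0.
  have Hx : H (val x) by apply/SP; exact: valP.
  have [|r [a [a0 rx]]] := HU _ Hx.
    by apply: contra_neq x0 => x0; apply: val_inj; rewrite x0 raddf0.
  by exists r, a; split=> //; apply: val_inj; rewrite !GRing.valZ SubK.
move=> L g sL lg; pose f a := val (g a).
have lf : linear_on L f.
  by move=> a x y Lx Ly; rewrite /f lg // linearP.
pose U' : set (R^o * D)%type := [set p | H p.2 /\ (p.1 = 0 -> p.2 = 0)].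
have [|K [sK GK KU maxK]] := max_submod (graph_on_submod sL lf) (U := U').
  move=> p [_ pE]; rewrite /U' /= pE; split.
    by apply/SP; exact: valP.
  by move=> ->; exact: linear_on0 lf.
pose L' : set R^o := [set a | exists y, K (a, y)].
have /choice[h hP] : forall a, exists y, L' a -> K (a, y).
  move=> a; have [[y Ky]|nL] := pselect (L' a); first by exists y.
  by exists 0.
have funK a y y' : K (a, y) -> K (a, y') -> y = y'.
  move=> Ky Ky'; apply/eqP; rewrite -subr_eq0; apply/eqP.
  have /KU[_] : K ((a, y) - (a, y')) by apply: submodD => //; exact: submodN.
  by apply; exact: subrr.
have KD a c c' y y' : K (c, y) -> K (c', y') -> K (a *: c + c', a *: y + y').
  by move=> Ky Ky'; exact: (proj2 sK a _ _ Ky Ky').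
have sL' : is_submod L'.
  split; first by exists 0; case: sK.
  by move=> a c c' [y Ky] [y' Ky']; exists (a *: y + y'); exact: KD.
have lh : linear_on L' h.
  move=> a c c' Lc Lc'; apply: (funK (a *: c + c')).
    exact/hP/(proj2 sL').
  by apply: KD; exact: hP.
have [e eP] := bD L' h sL' lh.
have Ke a y : K (a, y) -> y = a *: e.
  move=> Ky; have La : L' a by exists y.
  by rewrite -eP //; apply: funK Ky _; exact: hP.
have He : H e.
  apply: (maxH (adjoin H e)) (mem_adjoin e sH).
  - exact: adjoin_submod.
  - exact: sub_adjoin.
  move=> _ [s [m [Hm ->]]].
  have [[y Ky]|nLs] := pselect (L' s).
    rewrite -(Ke _ _ Ky); apply: HU; apply: submodD => //.
    by have [] := KU _ Ky.
  (* If [(s, - m)] could be adjoined to [K], then [s] would lie in [L']. So some [t * s + p = 0]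
     with [K (p, q)] has a nonzero value [t *: - m + q], which equals [- t] times [s *: e + m]; a
     multiple of it in [R d] is the one sought. *)
  have : ~ (adjoin K (s : R^o, - m) `<=` U').
    move=> sub; apply: nLs; exists (- m).
    apply: (maxK _ _ _ sub) (mem_adjoin _ sK).
      exact: adjoin_submod.
    exact: sub_adjoin.
  move=> nsub; apply: contrapT => nU; apply: nsub => _ [t [[p q] [Kp ->]]].
  have Hq : H q by have [] := KU _ Kp.
  have Hv : H (t *: - m + q).
    by apply: submodD => //; apply: submodZ => //; exact: submodN.
  split=> [//|ts0]; apply: contrapT => /eqP v0; apply: nU => _.
  have [r [a [a0 rv]]] := HU _ Hv v0.
  exists (- (r * t)), a; split=> //; rewrite -rv (Ke _ _ Kp).
  have -> : p = - (t * s) by apply/eqP; rewrite -addr_eq0 addrC; exact/eqP.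
  rewrite scalerN !scaleNr -opprD scalerN -scalerA scalerDr scalerA.
  by rewrite [in RHS]addrC.
have eS : e \in S by exact/SP.
exists (Sub e eS) => a La; apply: val_inj; rewrite GRing.valZ SubK.
exact/Ke/GK.
Qed.

End Hull.

(** * The cycle of implications over a valuation ring *)

Section Equivalence.
Variables (R : comNzRingType) (P : set R).
Hypothesis chainR : chain_ring R.
Hypothesis maxP : maximal_ideal P.

Lemma maximal_nonunit (x y : R) : P x -> y * x != 1.
Proof.
have [[P0 PD PM] PT _] := maxP => Px; apply/eqP => yx.
apply: PT; apply/seteqP; split=> // z _.
by rewrite -[z]mulr1 -yx; exact/PM/PM.
Qed.

Lemma notin_maximal_unit (x : R) : ~ P x -> exists y, y * x = 1.
Proof.
have [[P0 PD PM] _ Pmax] := maxP => nPx.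
pose J : set R := [set y | exists c p, P p /\ y = c * x + p].
have Jx : J x by exists 1, 0; rewrite mul1r addr0.
have [||JP|JT] := Pmax J.
- split; first by exists 0, 0; rewrite mul0r addr0.
    move=> _ _ [c [p [Pp ->]]] [c' [p' [Pp' ->]]].
    exists (c + c'), (p + p'); split; first exact: PD.
    by rewrite mulrDl addrACA.
  move=> a _ [c [p [Pp ->]]]; exists (a * c), (a * p); split; first exact: PM.
  by rewrite mulrDr mulrA.
- by move=> p Pp; exists 0, p; rewrite mul0r add0r.
- by case: nPx; rewrite -JP.
have [c [p [Pp e1]]] : J 1 by rewrite JT.
(* In [1 = c * x + p], [x] cannot be a multiple of [p], so [p] is a multiple of [x], and so is 1. *)
have [[t xE]|[t pE]] := chainR x p.
  by case: nPx; rewrite xE; exact: PM.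
by exists (c + t); rewrite mulrDl -pE -e1.
Qed.

Lemma zero_divisors_maximal : zero_divisors R `<=` P.
Proof.
move=> x [z [z0 xz]]; apply: contrapT => /notin_maximal_unit[y yx].
by move: z0; rewrite -[z]mul1r -yx -mulrA xz mulr0 eqxx.
Qed.

Lemma locally_projective_zero_divisors :
  (forall M : lmodType R, singly_projective M -> locally_projective M) ->
  zero_divisors R = P.
Proof.
move=> slP; apply/seteqP; split; first exact: zero_divisors_maximal.
move=> s Ps; apply: contrapT => nzs.
have sreg t : t * s = 0 -> t = 0.
  move=> ts; apply/eqP; apply: contrapT => /negP t0.
  by apply: nzs; exists t; rewrite mulrC.
have [D [d [bD dreg]]] := regular_in_baer R.
(* A regular [s] divides every element of [D]; iterating a chosen division from [d] gives [y n] with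
   [s ^+ n *: y n = d]. *)
have /choice[sigma sigmaP] : forall x : D, exists y, x = s *: y.
  by move=> x; apply: baer_divide => // t /sreg ->; rewrite scale0r.
pose y n := iter n sigma d.
have yD n m : s ^+ m *: y (m + n)%N = y n.
  elim: m => [|m IHm]; first by rewrite scale1r.
  by rewrite exprSr -scalerA addSn /= -sigmaP.
(* The increasing union of the cyclic modules generated by the [y n] is a copy of R[1/s]. *)
pose A : set D := [set x | exists n r, x = r *: y n].
have Ay n m r : (n <= m)%N -> exists r', r *: y n = r' *: y m.
  by move=> nm; exists (r * s ^+ (m - n)); rewrite -scalerA -{2}(subnK nm) yD.
have sA : is_submod A.
  split; first by exists 0%N, 0; rewrite scale0r.
  move=> a _ _ [n [r ->]] [n' [r' ->]]; exists (maxn n n').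
  have [q ->] := Ay n (maxn n n') r (leq_maxl _ _).
  have [q' ->] := Ay n' (maxn n n') r' (leq_maxr _ _).
  by exists (a * q + q'); rewrite scalerDl scalerA.
have [S [N SP]] := submod_lmodule sA.
have yS n : y n \in S by apply/SP; exists n, 1; rewrite scale1r.
pose Y n : N := Sub (y n) (yS n).
have YD m : Y 0%N = s ^+ m *: Y m.
  by apply: val_inj; rewrite GRing.valZ !SubK -{1}(yD 0%N m) addn0.
have Yreg t n : t *: Y n = 0 -> t = 0.
  move=> tY; apply: dreg; have: val (t *: Y 0%N) = 0.
    by rewrite (YD n) scalerA mulrC -scalerA tY scaler0 raddf0.
  by rewrite GRing.valZ SubK.
have NE (x : N) : exists n r, x = r *: Y n.
  have /SP[n [r xE]] := valP x.
  by exists n, r; apply: val_inj; rewrite GRing.valZ SubK.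
have /slP lN : singly_projective N.
  apply: factor_singly_projective => x; have [n [r ->]] := NE x.
  by exists r, (Y n); split=> // t; rewrite scalerA => /Yreg.
have [S' [N' [g [gE gP]]]] := @span_lmodule _ N 1 (fun=> Y 0%N).
have [|F [phi [pi [/free_coordinates[k kP] piK]]]] := lN S' N'.
  by exists 1%N, g.
have {}piK : pi (phi (Y 0%N)) = Y 0%N by rewrite -(gE ord0) piK.
have [l lE] := proj2 kP (phi (Y 0%N)).
(* The finitely many [pi b] lie in a single term of the increasing union. *)
have [m mP] : exists m, forall b, b \in l -> exists r, pi b = r *: Y m.
  elim: (l) => [|b l' [m mP]]; first by exists 0%N.
  have YM n n' r : (n <= n')%N -> exists r', r *: Y n = r' *: Y n'.
    move=> nn; have [q qE] := Ay n n' r nn.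
    by exists q; apply: val_inj; rewrite !GRing.valZ !SubK.
  have [n [r bE]] := NE (pi b); exists (maxn n m) => c.
  rewrite inE => /predU1P[->|/mP[q ->]].
    by rewrite bE; apply: YM; exact: leq_maxl.
  by apply: YM; exact: leq_maxr.
have {mP}/choice[r rP] : forall b, exists r, b \in l -> pi b = r *: Y m.
  move=> b; case: (boolP (b \in l)) => [/mP[r ->]|_]; first by exists r.
  by exists 0.
(* Starting from [Y m.+1] yields one more factor [s] than [Y m] absorbs: [Y 0] is [s ^+ m.+1 * q]
   times [Y m], hence [s * q] times itself. *)
pose q := \sum_(b <- l) k (phi (Y m.+1)) b * r b.
have Yq : Y 0%N = (s * q) *: Y 0%N.
  rewrite -[LHS]piK lE linear_sum {2}(YD m) scalerA mulrAC -exprS.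
  rewrite /q mulr_sumr scaler_suml big_seq [RHS]big_seq.
  apply: eq_bigr => b bl; rewrite linearZ_LR rP // scalerA.
  by rewrite (YD m.+1) linearZ_LR (coordinatesZ kP) mulrA.
suff qs : q * s = 1 by have := maximal_nonunit q Ps; rewrite qs eqxx.
apply/esym/eqP; rewrite -subr_eq0; apply/eqP/(Yreg _ 0%N).
by rewrite scalerBl scale1r mulrC -Yq subrr.
Qed.

Lemma essential_single_factor (E : lmodType R) (d : E) :
  zero_divisors R = P -> baer E -> essential_over d -> single_factor E.
Proof.
move=> ZP bE [dreg dess] x.
have [->|/dess[r [a [a0 rx]]]] := eqVneq x 0.
  by exists 0, 0; rewrite scaler0; split=> // t _; rewrite mulr0.
have rann t : r * t = 0 -> a * t = 0.
  move=> rt; apply: dreg.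
  by rewrite mulrC -scalerA -rx scalerA mulrC rt scale0r.
(* As [Z = P], [r] generates the annihilator of its annihilator, which contains
   [a]. *)
have [b aE] : exists b, a = b * r.
  have [//|[c rE]] := chainR a r.
  have [Pc|/notin_maximal_unit[c' c'c]] := pselect (P c); last first.
    by exists c'; rewrite rE mulrA c'c mul1r.
  (* A zero-divisor [c] is impossible here: [z = w * a] gives [r * w = 0], hence [a * w = 0] and
     [z = 0]; [a = w * z] gives [r = 0], hence [a = 0]. *)
  have [z [z0 cz]] : zero_divisors R c by rewrite ZP.
  have [[w zE]|[w aE]] := chainR z a.
    case/eqP: z0; rewrite zE mulrC; apply: rann.
    by rewrite rE -mulrA [a * w]mulrC -zE.
  case/eqP: a0; rewrite -[a]mulr1; apply: rann.
  by rewrite mulr1 rE aE mulrCA cz mulr0.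
(* If [t = q * r], both sides say [q * a = 0]. If [r = q * t], either side would make [a] vanish. *)
have annE t : t *: x = 0 <-> t * b = 0.
  have [[q tE]|[q rE]] := chainR t r.
    have -> : t * b = q * a by rewrite tE aE -mulrA [r * b]mulrC.
    have -> : t *: x = (q * a) *: d by rewrite tE -[LHS]scalerA rx scalerA.
    by split=> [/dreg|->]; rewrite ?scale0r.
  split=> t0; case/eqP: a0; first apply: dreg.
    by rewrite -rx rE -scalerA t0 scaler0.
  by rewrite aE rE mulrCA [b * t]mulrC t0 mulr0.
have [t /annE //|e xE] := @baer_divide _ E b x bE.
by exists b, e; split=> // t /annE.
Qed.

Lemma finitely_projective_self_injective : zero_divisors R = P ->
  (forall M : lmodType R, singly_projective M -> finitely_projective M) ->
  self_injective R.
Proof.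
move=> ZP sfP; have [E [d [bE dE]]] := essential_hull R.
have /factor_singly_projective/sfP fE := essential_single_factor ZP bE dE.
have [dreg dess] := dE.
have Ed e : exists c, e = c *: d.
  have [S [N [g [gE gP]]]] := @span_lmodule _ E 2 (tnth [tuple d; e]).
  have [|F [u [v [/free_coordinates[k kP] uv]]]] := fE S N.
    by exists 2%N, g.
  pose g0 := g ord0; pose g1 := g ord_max.
  have g0E : val g0 = d by rewrite gE.
  have g1E : val g1 = e by rewrite gE.
  have uinj x y : u x = u y -> x = y.
    by move=> uxy; apply: val_inj; rewrite -!uv uxy.
  have [s sE] := proj2 kP (u g0).
  have [a [q [qP aP]]] := chain_gcd s (k (u g0)) chainR.
  (* All coordinates of [u g0] are multiples of [a], so a scalar killing [a] kills [d]. Being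
     regular, [a] lies outside [P] and is a unit. *)
  have areg t : t * a = 0 -> t = 0.
    move=> ta; apply: dreg; rewrite -g0E -GRing.valZ.
    rewrite (_ : t *: g0 = 0) ?raddf0 //; apply: uinj.
    rewrite linear0 linearZ_LR sE scaler_sumr big_seq big1 // => b bs.
    by rewrite scalerA qP // mulrCA ta mulr0 scale0r.
  have [i ia] : exists i, i * a = 1.
    apply: notin_maximal_unit; rewrite -ZP => -[z [z0 az]].
    by move: z0; rewrite (areg z) ?eqxx // mulrC.
  case: aP => [a0|[b bs aE]].
    by move: ia; rewrite a0 mulr0 => /esym/eqP; rewrite oner_eq0.
  (* This multiplier cancels the coordinate at [b]. A nonzero difference would have a multiple
     [c *: d] with [c] nonzero; coordinates at [b] then give [c * a = 0], against regularity of
     [a]. *)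
  exists (k (u g1) b * i); apply/eqP; rewrite -subr_eq0; apply: contrapT.
  move=> /negP/dess[r [c [c0 rc]]]; case/eqP: c0; apply: areg.
  have : r *: (g1 - (k (u g1) b * i) *: g0) = c *: g0.
    apply: val_inj; rewrite !GRing.valZ g0E -rc raddfB; congr (_ *: (_ - _)).
      exact: g1E.
    by rewrite [LHS]GRing.valZ g0E.
  move=> /(congr1 (fun x => k (u x) b)).
  rewrite linearZ_LR linearB linearZ_LR (coordinatesZ kP) (coordinatesB kP).
  rewrite (coordinatesZ kP) linearZ_LR (coordinatesZ kP) -aE => <-.
  by rewrite -mulrA ia mulr1 subrr mulr0.
(* As [E] consists of the multiples of the regular element [d], Baer's condition passes from [E] to
   [R]. *)
apply: baer_injective => L g sL lg.
have [|e eP] := bE L (fun a => g a *: d) sL.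
  by move=> a x y Lx Ly; rewrite lg // scalerDl -scalerA.
have [c cE] := Ed e; exists c => a La.
apply/eqP; rewrite -subr_eq0; apply/eqP/dreg.
by rewrite scalerBl eP // cE -scalerA subrr.
Qed.

End Equivalence.

Theorem corollary4p7 (R : comNzRingType) (P : set R)
    (hR : valuation_ring R) (hP : maximal_ideal P) :
  [<-> self_injective R;
       forall M : lmodType R, singly_projective M -> locally_projective M;
       zero_divisors R = P /\
       forall M : lmodType R, singly_projective M -> finitely_projective M].
Proof.
have chainR := valuation_chain hR; tfae.
- by move=> injR M; exact: self_injective_locally_projective.
- move=> slP; split; first exact: locally_projective_zero_divisors.
  by move=> M /slP/locally_finitely_projective.
- by move=> [ZP sfP]; exact: finitely_projective_self_injective ZP sfP.
Qed.
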